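(* Let $\Gamma$ be a discrete amenable group, equipped with a measure $m$ that is left invariant, right invariant and inverse invariant. Let $n\ge1$ be an integer and let $f\colon\Gamma\to\mathrm{Sym}(n)$ be a function. Then there are an integer $N$ and a group homomorphism $h\colon\Gamma\to\mathrm{Sym}(N)$ such that $d_1(h,f)\le2913\,\mathrm{def}_1(f)$ and $n\le N\le(1+1740\,\mathrm{def}_1(f))\,n$.
   Context: A measure on a discrete group $\Gamma$ means a finitely additive probability measure $m\colon\mathcal P(\Gamma)\to[0,1]$ defined on all subsets of $\Gamma$. It is left (resp. right, inverse) invariant if $m(\gamma A)=m(A)$ (resp. $m(A\gamma)=m(A)$, $m(A^{-1})=m(A)$) for all $\gamma\in\Gamma$, $A\subset\Gamma$. Every discrete amenable group admits a measure that is left, right and inverse invariant. Bounded functions $\Gamma\to\mathbb C$ are integrated with respect to $m$ (the positive linear functional on bounded functions with $\int\mathbf 1_A\,dm=m(A)$). Write $[n]=\{1,\dots,n\}$. For integers $1\le n\le N$, $\sigma\in\mathrm{Sym}(n)$ and $\tau\in\mathrm{Sym}(N)$, put $d^H(\sigma,\tau)=d^H(\tau,\sigma)=\frac1N\left(|\{x\in[n] : \sigma(x)\ne\tau(x)\}|+(N-n)\right)$. For functions $f\colon\Gamma\to\mathrm{Sym}(n)$ and $h\colon\Gamma\to\mathrm{Sym}(N)$: $\mathrm{def}_1(f)=\int\left(\int d^H(f(\gamma_1\gamma_2),f(\gamma_1)f(\gamma_2))\,dm(\gamma_1)\right)dm(\gamma_2)$ (iterated integral, inner variable $\gamma_1$)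 and $d_1(f,h)=d_1(h,f)=\int d^H(f(\gamma),h(\gamma))\,dm(\gamma)$. *)

(* Defs.v *)
From HB Require Import structures.
From mathcomp Require Import all_boot all_order all_algebra all_fingroup.
From mathcomp Require Import all_classical all_reals.
From mathcomp Require Import ring lra.

Set Implicit Arguments.
Unset Strict Implicit.
Unset Printing Implicit Defensive.

Import Order.TTheory GRing.Theory Num.Theory.

Local Open Scope classical_set_scope.
Local Open Scope ring_scope.

Section Measure.
Context {R : realType}.

Record fa_probability {G : Type} (m : set G -> R) : Prop := FAProbability {
  fa_itv : forall A, 0 <= m A <= 1 ;
  fa_setT : m setT = 1 ;
  fa_setU : forall A B, A `&` B = set0 -> m (A `|` B) = m A + m B }.

Lemma fa_ge0 {G : Type} (m : set G -> R) (A : set G) :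
  fa_probability m -> 0 <= m A.
Proof. by move=> mP; case/andP: (fa_itv mP A). Qed.

Definition left_invariant {G : groupType} (m : set G -> R) : Prop :=
  forall (g : G) (A : set G), m [set (g * x)%g | x in A] = m A.

Definition right_invariant {G : groupType} (m : set G -> R) : Prop :=
  forall (g : G) (A : set G), m [set (x * g)%g | x in A] = m A.

Definition inverse_invariant {G : groupType} (m : set G -> R) : Prop :=
  forall A : set G, m [set (x^-1)%g | x in A] = m A.

End Measure.

Definition amenable (R : realType) (G : groupType) : Prop :=
  exists m : set G -> R, fa_probability m /\ left_invariant m.

Section Integral.
Context {R : realType} {G : Type}.
Implicit Types (m : set G -> R) (f g : G -> R).

Definition bounded_real f : Prop := exists M : R, forall x, `|f x| <= M.

(* A simple function is [c \o p], where the fibres of [p : G -> I] form a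
   finite partition of [G]. *)
Definition simple_sum m (I : finType) (p : G -> I) (c : I -> R) : R :=
  \sum_i c i * m (p @^-1` [set i]).

Definition lower_sums m f : set R :=
  [set s | exists (I : finType) (p : G -> I) (c : I -> R),
     (forall x, c (p x) <= f x) /\ s = simple_sum m p c].

(* By [fa_integral_mean] and [fa_integral_unique] below, on bounded functions
   this is the unique positive linear functional extending [m]. *)
Definition fa_integral m f : R := sup (lower_sums m f).

Record is_mean m (J : (G -> R) -> R) : Prop := IsMean {
  mean_add : forall f g, bounded_real f -> bounded_real g ->
    J (fun x => f x + g x) = J f + J g ;
  mean_scale : forall (a : R) f, bounded_real f ->
    J (fun x => a * f x) = a * J f ;
  mean_ge0 : forall f, bounded_real f -> (forall x, 0 <= f x) -> 0 <= J f ;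
  mean_indic : forall A : set G, J (fun x => (x \in A)%:R) = m A }.

Section Theory.
Variables (m : set G -> R) (mP : fa_probability m).

Lemma fa_set0 : m set0 = 0.
Proof.
have := fa_setU mP (setI0 set0); rewrite setU0 => /eqP.
by rewrite -subr_eq0 opprD addrA subrr sub0r oppr_eq0 => /eqP.
Qed.

Lemma fa_fibres (I : finType) (p : G -> I) (A : set G) :
  m A = \sum_i m (A `&` p @^-1` [set i]).
Proof.
have key (s : seq I) : uniq s ->
    m (A `&` [set x | p x \in s]) = \sum_(i <- s) m (A `&` p @^-1` [set i]).
  elim: s => [|i s IH] /=.
    move=> _; rewrite big_nil -fa_set0; congr m.
    by apply/seteqP; split=> x //= -[].
  move=> /andP[nis us]; rewrite big_cons -IH// -(fa_setU mP).
    congr m; apply/seteqP; split=> x /=.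
      by move=> [Ax]; rewrite in_cons => /orP[/eqP->|ps]; [left|right].
    by move=> [[Ax ->]|[Ax ps]]; split=> //; rewrite in_cons ?eqxx ?ps ?orbT.
  by apply/seteqP; split=> x //= -[[_ px] [_]]; rewrite px (negbTE nis).
have := key (enum I) (enum_uniq I).
rewrite big_enum /= => <-; congr m; apply/seteqP; split=> x /=.
  by rewrite mem_enum.
by case.
Qed.

Lemma simple_sum_refinel (I K : finType) (p : G -> I) (q : G -> K) c :
  simple_sum m p c = simple_sum m (fun x => (p x, q x)) (fun ik => c ik.1).
Proof.
rewrite /simple_sum.
rewrite [RHS](eq_bigr (fun ik : I * K =>
  c ik.1 * m ((fun x => (p x, q x)) @^-1` [set (ik.1, ik.2)]))); last by move=> [].
rewrite -(pair_bigA _ (fun i k =>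
  c i * m ((fun x => (p x, q x)) @^-1` [set (i, k)]))) /=.
apply: eq_bigr => i _; rewrite (fa_fibres q) mulr_sumr; apply: eq_bigr => k _.
congr (_ * m _); apply/seteqP; split=> x /=.
  by move=> [-> ->].
by case.
Qed.

Lemma simple_sum_refiner (I K : finType) (p : G -> I) (q : G -> K) c :
  simple_sum m q c = simple_sum m (fun x => (p x, q x)) (fun ik => c ik.2).
Proof.
rewrite /simple_sum.
rewrite [RHS](eq_bigr (fun ik : I * K =>
  c ik.2 * m ((fun x => (p x, q x)) @^-1` [set (ik.1, ik.2)]))); last by move=> [].
rewrite -(pair_bigA _ (fun i k =>
  c k * m ((fun x => (p x, q x)) @^-1` [set (i, k)]))) /=.
rewrite exchange_big /=.
apply: eq_bigr => k _; rewrite (fa_fibres p) mulr_sumr; apply: eq_bigr => i _.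
congr (_ * m _); apply/seteqP; split=> x /=.
  by move=> [-> ->].
by case.
Qed.

Lemma simple_sum_le (I K : finType) (p : G -> I) (q : G -> K) c d :
  (forall x, c (p x) <= d (q x)) -> simple_sum m p c <= simple_sum m q d.
Proof.
move=> le; rewrite (simple_sum_refinel p q) (simple_sum_refiner p q).
apply: ler_sum => -[i k] _ /=.
have [->|/set0P[x /= [<- <-]]] :=
  eqVneq ((fun x => (p x, q x)) @^-1` [set (i, k)]) set0.
  by rewrite fa_set0 !mulr0.
by apply: ler_wpM2r => //; exact: fa_ge0.
Qed.

Lemma simple_sumD (I K : finType) (p : G -> I) (q : G -> K) c d :
  simple_sum m (fun x => (p x, q x)) (fun ik => c ik.1 + d ik.2) =
  simple_sum m p c + simple_sum m q d.
Proof.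
rewrite (simple_sum_refinel p q) (simple_sum_refiner p q) -big_split /=.
by apply: eq_bigr => ik _; rewrite mulrDl.
Qed.

Lemma simple_sumZ (I : finType) (p : G -> I) a c :
  simple_sum m p (fun i => a * c i) = a * simple_sum m p c.
Proof. by rewrite mulr_sumr; apply: eq_bigr => i _; rewrite mulrA. Qed.

Lemma simple_sum_shift (I : finType) (p : G -> I) c e :
  simple_sum m p (fun i => c i + e) = simple_sum m p c + e.
Proof.
rewrite /simple_sum; under eq_bigr do rewrite mulrDl.
rewrite big_split /= -mulr_sumr; congr (_ + _).
have := fa_fibres p setT; rewrite (fa_setT mP).
by under eq_bigr do rewrite setTI; move=> <-; rewrite mulr1.
Qed.

Lemma fa_integral_bounds (I K : finType) (p : G -> I) (q : G -> K) c d f :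
  (forall x, c (p x) <= f x) -> (forall x, f x <= d (q x)) ->
  simple_sum m p c <= fa_integral m f <= simple_sum m q d.
Proof.
move=> cf fd.
have ub : ubound (lower_sums m f) (simple_sum m q d).
  move=> _ [J [r [e [ef ->]]]]; apply: simple_sum_le => x.
  exact: le_trans (fd x).
have cL : lower_sums m f (simple_sum m p c) by exists I, p, c.
apply/andP; split.
  by apply: ub_le_sup => //; exists (simple_sum m q d).
by apply: ge_sup => //; exists (simple_sum m p c).
Qed.

Lemma simple_approx f (e : R) : bounded_real f -> 0 < e ->
  exists (I : finType) (p : G -> I) (c : I -> R),
    forall x, c (p x) <= f x <= c (p x) + e.
Proof.
move=> [M fM] e0.
pose k x := Num.truncn ((f x + M) / e).
have fM0 x : 0 <= (f x + M) / e.
  apply: divr_ge0 (ltW e0); move: (fM x); rewrite ler_norml => /andP[? _]; lra.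
have kb x : (k x < (Num.truncn ((M + M) / e)).+1)%N.
  rewrite ltnS; apply: le_truncn; rewrite ler_pM2r ?invr_gt0// lerD2r.
  exact: le_trans (ler_norm _) (fM x).
exists 'I_(Num.truncn ((M + M) / e)).+1, (fun x => Ordinal (kb x)),
  (fun i => (nat_of_ord i)%:R * e - M) => x /=.
have /andP[] := truncn_itv (fM0 x).
rewrite -/(k x) ler_pdivlMr// ltr_pdivrMr// -natr1 => h1 h2.
by apply/andP; split; lra.
Qed.

Lemma fa_integral_simple (I : finType) (p : G -> I) c :
  fa_integral m (fun x => c (p x)) = simple_sum m p c.
Proof.
by apply/le_anti; rewrite andbC; apply: fa_integral_bounds => x.
Qed.

Lemma simple_sum_indic (A : set G) :
  simple_sum m (fun x => x \in A) (fun b : bool => b%:R) = m A.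
Proof.
rewrite /simple_sum big_bool /= mul0r addr0 mul1r; congr m.
by apply/seteqP; split=> x /=; [move/set_mem|move/mem_set].
Qed.

Lemma eps_eq (a b C : R) :
  (forall e, 0 < e -> `|a - b| <= C * e) -> a = b.
Proof.
move=> h; apply/eqP; rewrite -subr_eq0 -normr_le0.
apply/ler_addgt0Pl => e e0; rewrite addr0.
have C0 : 0 < `|C| + 1 by rewrite ltr_wpDl.
have := h (e / (`|C| + 1)) (divr_gt0 e0 C0).
move=> /le_trans; apply.
rewrite mulrCA ger_pMr// ler_pdivrMr// mul1r.
by apply: le_trans (ler_norm C) _; rewrite lerDl.
Qed.

Lemma fa_integralD f g : bounded_real f -> bounded_real g ->
  fa_integral m (fun x => f x + g x) = fa_integral m f + fa_integral m g.
Proof.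
move=> bf bg; apply: (@eps_eq _ _ 2) => e e0.
have [I [p [c cf]]] := simple_approx bf e0.
have [K [q [d dg]]] := simple_approx bg e0.
have /andP[f1 f2] : simple_sum m p c <= fa_integral m f
    <= simple_sum m p (fun i => c i + e).
  by apply: fa_integral_bounds => x; case/andP: (cf x).
have /andP[g1 g2] : simple_sum m q d <= fa_integral m g
    <= simple_sum m q (fun i => d i + e).
  by apply: fa_integral_bounds => x; case/andP: (dg x).
have /andP[h1 h2] :
    simple_sum m (fun x => (p x, q x)) (fun ik => c ik.1 + d ik.2)
    <= fa_integral m (fun x => f x + g x) <=
    simple_sum m (fun x => (p x, q x))
      (fun ik => (c ik.1 + e) + (d ik.2 + e)).
  apply: fa_integral_bounds => x /=; case/andP: (cf x) => ? ?;
  by case/andP: (dg x) => ? ?; apply: lerD.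
rewrite (simple_sumD p q (fun i => c i + e) (fun i => d i + e)) in h2.
rewrite simple_sumD in h1; rewrite !simple_sum_shift in f2 g2 h2.
by rewrite ler_norml; apply/andP; split; lra.
Qed.

Lemma fa_integralZ_ge0 a f : 0 <= a -> bounded_real f ->
  fa_integral m (fun x => a * f x) = a * fa_integral m f.
Proof.
move=> a0 bf; apply: (@eps_eq _ _ a) => e e0.
have [I [p [c cf]]] := simple_approx bf e0.
have /andP[f1 f2] : simple_sum m p c <= fa_integral m f
    <= simple_sum m p (fun i => c i + e).
  by apply: fa_integral_bounds => x; case/andP: (cf x).
have /andP[h1 h2] : simple_sum m p (fun i => a * c i)
    <= fa_integral m (fun x => a * f x)
    <= simple_sum m p (fun i => a * (c i + e)).
  by apply: fa_integral_bounds => x; apply: ler_wpM2l => //;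
    case/andP: (cf x).
rewrite !simple_sumZ simple_sum_shift in h1 h2; rewrite simple_sum_shift in f2.
have := ler_wpM2l a0 f1; have := ler_wpM2l a0 f2.
rewrite mulrDr in h2 *.
by rewrite ler_norml => *; apply/andP; split; lra.
Qed.

Lemma fa_integral_ge0 f : bounded_real f -> (forall x, 0 <= f x) ->
  0 <= fa_integral m f.
Proof.
move=> [M fM] f0.
have /andP[+ _] : simple_sum m (fun=> tt) (fun=> 0) <= fa_integral m f
    <= simple_sum m (fun=> tt) (fun=> M).
  apply: fa_integral_bounds => x //.
  exact: le_trans (ler_norm _) (fM x).
by apply: le_trans; rewrite /simple_sum big1// => i _; rewrite mul0r.
Qed.

Lemma fa_integralN f : bounded_real f ->
  fa_integral m (fun x => - f x) = - fa_integral m f.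
Proof.
move=> bf; apply/eqP; rewrite -addr_eq0 -fa_integralD//; last first.
  by case: bf => M fM; exists M => x; rewrite normrN.
under eq_fun do rewrite addNr.
rewrite (fa_integral_simple (fun=> tt) (fun=> 0)) /simple_sum.
by rewrite big1// => i _; rewrite mul0r.
Qed.

Theorem fa_integral_mean : is_mean m (fa_integral m).
Proof.
split.
- exact: fa_integralD.
- move=> a f bf; have [a0|a0] := leP 0 a; first exact: fa_integralZ_ge0.
  rewrite -[in RHS](opprK a) mulNr -fa_integralZ_ge0 ?oppr_ge0 ?ltW//.
  rewrite -fa_integralN; first by under [in RHS]eq_fun do rewrite mulNr opprK.
  case: bf => M fM; exists (`|a| * M) => x.
  by rewrite normrM normrN ler_wpM2l.
- exact: fa_integral_ge0.
- by move=> A; rewrite (fa_integral_simple (fun x => x \in A)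
    (fun b : bool => b%:R)) simple_sum_indic.
Qed.

Theorem fa_integral_unique (J : (G -> R) -> R) : is_mean m J ->
  forall f, bounded_real f -> J f = fa_integral m f.
Proof.
move=> [JD JZ J0 J1].
have bindic (A : set G) : bounded_real (fun x => (x \in A)%:R).
  by exists 1 => x; rewrite normr_nat lern1 leq_b1.
have bZ a f : bounded_real f -> bounded_real (fun x => a * f x).
  by move=> [M fM]; exists (`|a| * M) => x; rewrite normrM ler_wpM2l.
have bD f g : bounded_real f -> bounded_real g ->
    bounded_real (fun x => f x + g x).
  move=> [M fM] [N gN]; exists (M + N) => x.
  by apply: le_trans (ler_normD _ _) _; apply: lerD.
have Jle f g : bounded_real f -> bounded_real g ->
    (forall x, f x <= g x) -> J f <= J g.
  move=> bf bg fg; have bf' := bZ (-1) _ bf.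
  have := J0 _ (bD _ _ bg bf').
  rewrite JD// JZ// mulN1r subr_ge0; apply => x.
  by rewrite mulN1r subr_ge0.
have JS (I : finType) (p : G -> I) c :
    bounded_real (fun x => c (p x)) /\
    J (fun x => c (p x)) = simple_sum m p c.
  pose F (s : seq I) x := \sum_(i <- s) c i * (x \in p @^-1` [set i])%:R.
  have FE : (fun x => c (p x)) = F (index_enum I).
    apply/funext => x; rewrite /F (bigD1 (p x)) //= big1 ?addr0.
      by rewrite mem_set// mulr1.
    move=> i ip; rewrite memNset ?mulr0//= => pi.
    by rewrite pi eqxx in ip.
  have : bounded_real (F (index_enum I)) /\ J (F (index_enum I)) =
      \sum_(i <- index_enum I) c i * m (p @^-1` [set i]).
    elim: (index_enum I) => [|i s [bs IH]].
      have -> : F [::] = (fun x => 0 * (x \in set0)%:R).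
        by apply/funext => x; rewrite /F big_nil mul0r.
      by split; [exact: bZ|rewrite JZ// mul0r big_nil].
    have -> : F (i :: s) =
        (fun x => c i * (x \in p @^-1` [set i])%:R + F s x).
      by apply/funext => x; rewrite /F big_cons.
    split; first by apply: bD => //; exact: bZ.
    by rewrite JD ?JZ ?J1 ?IH ?big_cons//; exact: bZ.
  by rewrite FE.
move=> f bf; apply: (@eps_eq _ _ 1) => e e0.
have [I [p [c cf]]] := simple_approx bf e0.
have /andP[f1 f2] : simple_sum m p c <= fa_integral m f
    <= simple_sum m p (fun i => c i + e).
  by apply: fa_integral_bounds => x; case/andP: (cf x).
have [b1 e1] := JS I p c; have [b2 e2] := JS I p (fun i => c i + e).
have j1 : simple_sum m p c <= J f.
  by rewrite -e1; apply: Jle => // x; case/andP: (cf x).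
have j2 : J f <= simple_sum m p (fun i => c i + e).
  by rewrite -e2; apply: Jle => // x; case/andP: (cf x).
rewrite simple_sum_shift in f2 j2.
by rewrite ler_norml; apply/andP; split; lra.
Qed.

End Theory.
End Integral.

(* The library product of permutations applies its left factor first, whereas
   products in Sym(n) are composed right to left:
   [perm_comp s t x = s (t x)]. *)
Definition perm_comp n (s t : 'S_n) : 'S_n := (t * s)%g.

Lemma perm_compE n (s t : 'S_n) x : perm_comp s t x = s (t x).
Proof. exact: permM. Qed.

(* [n] is ['I_n], i.e. {0, ..., n - 1}, included in ['I_N] by [widen_ord]. *)
Definition dH (R : realType) n N (le_nN : (n <= N)%N)
    (s : 'S_n) (t : 'S_N) : R :=
  N%:R^-1 *
  (#|[set x : 'I_n | widen_ord le_nN (s x) != t (widen_ord le_nN x)]|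
   + (N - n))%N%:R.

Section Defect.
Context {R : realType} {G : groupType}.
Variable m : set G -> R.

Definition def1 n (f : G -> 'S_n) : R :=
  fa_integral m (fun g2 => fa_integral m (fun g1 =>
    dH R (leqnn n) (f (g1 * g2)%g) (perm_comp (f g1) (f g2)))).

Definition d1 n N (le_nN : (n <= N)%N) (f : G -> 'S_n) (h : G -> 'S_N) : R :=
  fa_integral m (fun g => dH R le_nN (f g) (h g)).

End Defect.

(* Main.v *)
(** Let [G] act on the maps [u : G -> 'I_n] by right translation, with the
    invariant pseudometric [d u v = m {u <> v}].  The maps [orb x = (c |-> f c x)]
    are at mutual distance 1, and [def1 m f] is the average over [x] and [g] of
    the distance from [g . orb x] to [orb (f g x)].  Call [u] stable if [g . u]
    is within 1/6 of some [orb y] for more than half of the [g].  Any two stable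
    maps have translates by a common [g] that are near the [orb]s, so their
    distance is either [< 1/3] or [> 2/3]: hence closeness is an invariant
    equivalence relation on stable maps, and [G] acts on its classes.  By Markov,
    all but [O(def1 m f) n] of the [orb x] are stable, and counting how often a
    translate of a class lands near the [orb]s bounds the number of classes that
    contain no [orb x] by [O(def1 m f) n].  The homomorphism [h] is the action on
    the classes, extended trivially to the unstable points. *)

Require Import Defs.
From HB Require Import structures.
From mathcomp Require Import all_boot all_order all_algebra all_fingroup.
From mathcomp Require Import all_classical all_reals.
From mathcomp Require Import lra.
Set Implicit Arguments.
Unset Strict Implicit.
Unset Printing Implicit Defensive.
Import Order.TTheory GRing.Theory Num.Theory.
Local Open Scope classical_set_scope.
Local Open Scope ring_scope.


(** * Monotonicity and linearity for finitely additive measures *)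

Section Integration.
Context {R : realType} {T : Type} {m : set T -> R}.
Hypothesis mP : fa_probability m.

Lemma fa_le (A B : set T) : A `<=` B -> m A <= m B.
Proof.
move=> AB; rewrite -[B](setDUK AB) (fa_setU mP) ?setDIK// lerDl.
exact: fa_ge0.
Qed.

Lemma fa_setC (A : set T) : m (~` A) = 1 - m A.
Proof.
by rewrite -(fa_setT mP) -(setUv A) (fa_setU mP) ?setICr// addrC addKr.
Qed.

Lemma fa_leU (A B C : set T) : A `<=` B `|` C -> m A <= m B + m C.
Proof.
move=> /fa_le/le_trans; apply.
have -> : B `|` C = B `|` (C `\` B).
  by rewrite setUDr setDv setD0.
rewrite (fa_setU mP) ?setDIK// lerD2l; apply: fa_le; exact: subDsetl.
Qed.

Lemma fa_meet (A B : set T) : 1 < m A + m B -> exists2 x, A x & B x.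
Proof.
move=> AB; apply: contrapT => nAB.
have : m A <= m (~` B).
  by apply: fa_le => x Ax Bx; apply: nAB; exists x.
rewrite fa_setC; lra.
Qed.

Lemma bounded_itv (f : T -> R) (M : R) :
  (forall x, 0 <= f x <= M) -> bounded_real f.
Proof.
by move=> fM; exists M => x; case/andP: (fM x) => f0 ?; rewrite ger0_norm.
Qed.

Lemma bounded_scale (a : R) (f : T -> R) :
  bounded_real f -> bounded_real (fun x => a * f x).
Proof. by case=> M fM; exists (`|a| * M) => x; rewrite normrM ler_wpM2l. Qed.

Lemma bounded_add (f g : T -> R) :
  bounded_real f -> bounded_real g -> bounded_real (fun x => f x + g x).
Proof.
move=> [M fM] [N gN]; exists (M + N) => x.
by apply: le_trans (ler_normD _ _) _; apply: lerD.
Qed.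

Lemma bounded_cst (a : R) : bounded_real (fun=> a : R) (G := T).
Proof. by exists `|a|. Qed.

Lemma bounded_indic (A : set T) : bounded_real (fun x => (x \in A)%:R : R).
Proof. by apply: (@bounded_itv _ 1) => x; case: (x \in A); rewrite /= ?lexx ?ler01. Qed.

Lemma bounded_sum (I : Type) (s : seq I) (f : I -> T -> R) :
  (forall i, bounded_real (f i)) -> bounded_real (fun x => \sum_(i <- s) f i x).
Proof.
move=> bf; elim: s => [|i s IH].
  by under eq_fun do rewrite big_nil; exact: bounded_cst.
by under eq_fun do rewrite big_cons; exact: bounded_add.
Qed.

Lemma fa_integral_cst (a : R) : fa_integral m (fun=> a) = a.
Proof.
rewrite (fa_integral_simple mP (fun=> tt) (fun=> a)) /simple_sum.
rewrite (big_pred1 tt); last by case.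
have -> : (fun=> tt) @^-1` [set tt] = [set: T] by apply/seteqP; split.
by rewrite (fa_setT mP) mulr1.
Qed.

Lemma fa_integralZ (a : R) (f : T -> R) : bounded_real f ->
  fa_integral m (fun x => a * f x) = a * fa_integral m f.
Proof. exact: mean_scale (fa_integral_mean mP) _ _. Qed.

Lemma fa_integral_indic (A : set T) :
  fa_integral m (fun x => (x \in A)%:R) = m A.
Proof. exact: mean_indic (fa_integral_mean mP) _. Qed.

Lemma fa_integral_sum (I : Type) (s : seq I) (f : I -> T -> R) :
  (forall i, bounded_real (f i)) ->
  fa_integral m (fun x => \sum_(i <- s) f i x) =
  \sum_(i <- s) fa_integral m (f i).
Proof.
move=> bf; elim: s => [|i s IH].
  by under eq_fun do rewrite big_nil; rewrite big_nil fa_integral_cst.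
under eq_fun do rewrite big_cons.
by rewrite big_cons -IH fa_integralD//; exact: bounded_sum.
Qed.

Lemma fa_integral_le (f g : T -> R) : bounded_real f -> bounded_real g ->
  (forall x, f x <= g x) -> fa_integral m f <= fa_integral m g.
Proof.
move=> bf bg fg; rewrite -subr_ge0 -mulN1r -fa_integralZ// -fa_integralD//;
  last exact: bounded_scale.
apply: fa_integral_ge0 => //; first by apply: bounded_add => //; exact: bounded_scale.
by move=> x; rewrite mulN1r subr_ge0.
Qed.

End Integration.

(** Picking a related element of [Q] is an injection on [P]; its values stay in [option B], which
    avoids choosing a default in [B]. *)
Lemma leq_card_rel (A B : finType) (P : {set A}) (Q : {set B}) (r : A -> B -> bool) :
  (forall a, a \in P -> exists2 b, b \in Q & r a b) ->
  (forall a a' b, r a b -> r a' b -> a = a') ->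
  (#|P| <= #|Q|)%N.
Proof.
move=> tot inj.
pose F a := [pick b in Q | r a b].
have FP a : a \in P -> exists b, [/\ F a = Some b, b \in Q & r a b].
  rewrite /F => /tot[b bQ rab]; case: pickP => [c /andP[? ?]|/(_ b)]; first by exists c.
  by rewrite bQ rab.
have Fi : {in P &, injective F}.
  move=> a a' /FP[b [-> _ rab]] /FP[b' [-> _ rab']] [eb].
  by apply: inj rab _; rewrite eb.
rewrite -(card_in_imset Fi) -(card_imset (mem Q) (@Some_inj _)).
apply/subset_leq_card/fintype.subsetP => _ /imsetP[a aP ->].
by have [b [-> bQ _]] := FP _ aP; rewrite imset_f.
Qed.

(** * Right translation of maps and the invariant pseudometric *)

Section Shift.
Context {R : realType} {G : groupType} {T : Type} (m : set G -> R).
Hypothesis (mP : fa_probability m) (mR : right_invariant m).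

Definition shift (g : G) (u : G -> T) : G -> T := fun c => u (c * g)%g.

Definition dist (u v : G -> T) : R := m [set c | u c <> v c].

Lemma shiftM g h u : shift g (shift h u) = shift (g * h)%g u.
Proof. by apply/funext => c; rewrite /shift mulgA. Qed.

(** The set on the left is the translate of [P] by [g^-1]. *)
Lemma fa_preshift (P : set G) g : m [set c | P (c * g)%g] = m P.
Proof.
rewrite -(mR g^-1%g P); congr m; apply/seteqP; split=> c /=.
  by move=> Pc; exists (c * g)%g => //; rewrite mulgK.
by move=> [x Px <-]; rewrite mulgVK.
Qed.

Lemma dist_shift g u v : dist (shift g u) (shift g v) = dist u v.
Proof. exact: (fa_preshift [set c | u c <> v c] g). Qed.

Lemma distC u v : dist u v = dist v u.
Proof. by congr m; apply/seteqP; split=> c /= /nesym. Qed.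

Lemma dist_triangle v u w : dist u w <= dist u v + dist v w.
Proof.
apply: (fa_leU mP) => c /= uw.
by have [uv|] := pselect (u c = v c); [right; rewrite -uv|left].
Qed.

Lemma dist_itv u v : 0 <= dist u v <= 1.
Proof. exact: fa_itv mP _. Qed.

End Shift.

(** The classical set counted in [dH] becomes a finite set, whose membership [inE] can unfold. *)
Lemma dHE (R : realType) n N (le_nN : (n <= N)%N) (s : 'S_n) (t : 'S_N) :
  dH R le_nN s t = N%:R^-1 *
  (#|finset (fun x : 'I_n => widen_ord le_nN (s x) != t (widen_ord le_nN x))|
   + (N - n))%N%:R.
Proof.
rewrite /dH; do 3!congr (_ _); congr addn; apply: eq_card => x.
by rewrite inE; apply/idP/idP => [/set_mem|/mem_set].
Qed.

(** * Stable maps and the gap between their distances *)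

Section Clusters.
Context {R : realType} {G : groupType} (m : set G -> R) (n : nat) (f : G -> 'S_n).
Hypothesis (mP : fa_probability m) (mR : right_invariant m).

Local Notation d := (dist m).

Definition orb (x : 'I_n) : G -> 'I_n := fun c => f c x.

(** With radius 1/6, two maps near the same [orb] are closer than 1/3, and maps near different ones
    are farther apart than 2/3. *)
Definition near (u : G -> 'I_n) : Prop := exists y, d u (orb y) < 6^-1.

Definition stable (u : G -> 'I_n) : Prop :=
  2^-1 < m [set g | near (shift g u)].

Definition err (x : 'I_n) (g : G) : R := d (shift g (orb x)) (orb (f g x)).

Definition unstable_points : {set 'I_n} := [set x | ~~ `[< stable (orb x) >]]%SET.

(** Off this set, [orb x] and [orb (f g x)] both represent classes and [g] carries the first class
    to the second, so the action on classes agrees with [f g] at [x]. *)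
Definition bad (g : G) : {set 'I_n} :=
  [set x | [|| x \in unstable_points, f g x \in unstable_points
             | 3^-1 <= err x g]]%SET.

Lemma stable_shift g u : stable u -> stable (shift g u).
Proof.
rewrite /stable -(fa_preshift mR [set h | near (shift h u)] g) /=.
by under eq_set do rewrite -shiftM.
Qed.

Lemma dist_orb x y : x != y -> d (orb x) (orb y) = 1.
Proof.
move=> xy; rewrite -(fa_setT mP); congr m; apply/seteqP; split=> c //= _.
by move=> /perm_inj exy; rewrite exy eqxx in xy.
Qed.

(** Two sets of measure above 1/2 share some [g], and translating by [g] preserves the distance. The
    two cases are whether the nearby [orb]s coincide. *)
Lemma stable_gap u v : stable u -> stable v -> d u v < 3^-1 \/ 2/3 < d u v.
Proof.
move=> su sv.
have [|g /= [x ux] [y vy]] := fa_meet mP (A := [set g | near (shift g u)])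
  (B := [set g | near (shift g v)]).
  by move: su sv; rewrite /stable; lra.
rewrite -(dist_shift mR g u v).
have [xy|xy] := eqVneq x y.
  left; have := dist_triangle mP (orb x) (shift g u) (shift g v).
  by move: vy; rewrite -xy distC; lra.
right.
have := dist_triangle mP (shift g u) (orb x) (orb y).
have := dist_triangle mP (shift g v) (shift g u) (orb y).
by rewrite dist_orb// (distC m (orb x)); lra.
Qed.

(** The triangle inequality gives less than 2/3, so the gap forces less than 1/3. *)
Lemma stable_trans v u w : stable u -> stable w ->
  d u v < 3^-1 -> d v w < 3^-1 -> d u w < 3^-1.
Proof.
move=> su sw uv vw; have [//|] := stable_gap su sw.
by have := dist_triangle mP v u w; lra.
Qed.

(** * Counting unstable and bad points *)

Lemma bounded_err x : bounded_real (err x).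
Proof. by apply: (@bounded_itv _ _ _ 1) => g; exact: dist_itv. Qed.

(** For a fixed second variable [g], the inner integral of [def1] averages over [c] the proportion
    of [x] with [f (c * g) x <> f c (f g x)]. Exchanging the integral with the finite sum over [x]
    turns this into the mean of [err x g]. *)
Lemma sum_err_integral : (0 < n)%N ->
  fa_integral m (fun g => \sum_x err x g) = n%:R * def1 m f.
Proof.
move=> n0; have nR : n%:R != 0 :> R by rewrite pnatr_eq0 -lt0n.
have bs : bounded_real (fun g => \sum_x err x g).
  by apply: bounded_sum => x; exact: bounded_err.
suff -> : def1 m f = fa_integral m (fun g => n%:R^-1 * \sum_x err x g).
  by rewrite fa_integralZ// mulrA divff// mul1r.
congr fa_integral; apply/funext => g.
rewrite (_ : (fun g1 => _) = fun g1 => n%:R^-1 * \sum_(x < n)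
    (g1 \in [set c | shift g (orb x) c <> orb (f g x) c])%:R); last first.
  apply/funext => c; rewrite dHE subnn addn0; congr (_ * _).
  rewrite -natr_sum -sum1_card big_mkcond /=; congr (_%:R).
  have wE y : widen_ord (leqnn n) y = y by exact: val_inj.
  apply: eq_bigr => x _; rewrite inE !wE perm_compE.
  rewrite /orb /shift; case: eqVneq => /= [e|/eqP ne].
    by rewrite memNset//= => /(_ e).
  by rewrite mem_set.
rewrite fa_integralZ//; last by apply: bounded_sum => x; exact: bounded_indic.
rewrite fa_integral_sum//; last by move=> x; exact: bounded_indic.
by congr (_ * _); apply: eq_bigr => x _; rewrite fa_integral_indic//.
Qed.

(** If [orb x] is unstable, at least half of the [g] have [err x g >= 1/6], so the integral of
    [err x] is at least 1/12. *)
Lemma card_unstable : (0 < n)%N ->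
  #|unstable_points|%:R <= 12 * (n%:R * def1 m f).
Proof.
move=> n0; rewrite -sum_err_integral// fa_integral_sum//; last exact: bounded_err.
have e0 x g : 0 <= err x g by case/andP: (dist_itv mP (shift g (orb x)) (orb (f g x))).
rewrite mulr_sumr -sum1_card natr_sum big_mkcond /=.
apply: ler_sum => x _; case: ifP => [|_]; last first.
  by rewrite mulr_ge0// fa_integral_ge0//; exact: bounded_err.
rewrite inE => /asboolPn; rewrite /stable => /negP; rewrite -leNgt.
set A := [set g | _] => mA.
have : m (~` A) <= 6 * fa_integral m (err x).
  rewrite -fa_integralZ//; last exact: bounded_err.
  rewrite -(fa_integral_indic mP); apply: fa_integral_le => //.
  - exact: bounded_indic.
  - by apply: bounded_scale; exact: bounded_err.
  move=> g; have [|_] := boolP (g \in ~` A); last by rewrite mulr_ge0.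
  move/set_mem => nA /=.
  have [lt|] := ltP (err x g) 6^-1; last by lra.
  by case: nA; exists (f g x).
by rewrite fa_setC//; lra.
Qed.

Lemma card_bad g :
  #|bad g|%:R <= 2 * #|unstable_points|%:R + 3 * \sum_x err x g.
Proof.
pose far : {set 'I_n} := [set x | 3^-1 <= err x g]%SET.
have e0 x : 0 <= err x g by case/andP: (dist_itv mP (shift g (orb x)) (orb (f g x))).
have -> : bad g = unstable_points :|: (f g @^-1: unstable_points :|: far).
  by apply/setP => x; rewrite !inE.
have hf : #|far|%:R <= 3 * \sum_x err x g.
  rewrite mulr_sumr -sum1_card natr_sum big_mkcond /=.
  apply: ler_sum => x _; case: ifP => [|_]; last by rewrite mulr_ge0.
  by rewrite inE; lra.
(* The factor 2 arises because the preimage under a permutation has the same size. *)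
have hp : #|f g @^-1: unstable_points| = #|unstable_points|.
  by rewrite card_preimset//; exact: perm_inj.
have [+ _] := leq_card_setU unstable_points (f g @^-1: unstable_points :|: far).
have [+ _] := leq_card_setU (f g @^-1: unstable_points) far.
rewrite hp -!(ler_nat R) !natrD; lra.
Qed.

Lemma bounded_bad : bounded_real (fun g => #|bad g|%:R : R).
Proof.
apply: (@bounded_itv _ _ _ n%:R) => g; rewrite ler0n ler_nat.
by rewrite -[X in (_ <= X)%N]card_ord max_card.
Qed.

Lemma bad_integral : (0 < n)%N ->
  fa_integral m (fun g => #|bad g|%:R) <= 27 * (n%:R * def1 m f).
Proof.
move=> n0.
have bs : bounded_real (fun g => \sum_x err x g).
  by apply: bounded_sum => x; exact: bounded_err.
have b1 := bounded_scale 3 bs.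
apply: (@le_trans _ _ (2 * #|unstable_points|%:R + 3 * (n%:R * def1 m f))).
  rewrite -sum_err_integral// -[2 * _](fa_integral_cst mP) -fa_integralZ//.
  rewrite -fa_integralD//; last exact: bounded_cst.
  apply: fa_integral_le => //; [exact: bounded_bad| |exact: card_bad].
  by apply: bounded_add => //; exact: bounded_cst.
(* The constant is 27 = 2 * 12 + 3. *)
have := card_unstable n0; lra.
Qed.

(* Representatives of [k] distinct classes of stable maps, none of which is the
   class of an [orb x]. *)
Definition new_classes (k : nat) (v : nat -> G -> 'I_n) : Prop :=
  [/\ forall i, (i < k)%N -> stable (v i),
      forall i j, (i < j < k)%N -> ~ d (v i) (v j) < 3^-1
    & forall i x, (i < k)%N -> stable (orb x) -> ~ d (v i) (orb x) < 3^-1].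

(** Charge to [i] a point [x] such that [shift g (v i)] is within 1/6 of [orb (f g x)]. Two indices
    charged to one point would give [v i] and [v j] closer than 1/3. *)
Lemma card_near_bad k v g : new_classes k v ->
  (#|[set i : 'I_k | `[< near (shift g (v i)) >]]%SET| <= #|bad g|)%N.
Proof.
move=> [sv vv vo].
apply: (@leq_card_rel _ _ _ _ (fun (i : 'I_k) x =>
  `[< d (shift g (v i)) (orb (f g x)) < 6^-1 >])); last first.
  have key (i j : 'I_k) x : d (shift g (v i)) (orb (f g x)) < 6^-1 ->
      d (shift g (v j)) (orb (f g x)) < 6^-1 -> ~ (i < j)%N.
    move=> ix jx ij; have := vv i j; rewrite ij ltn_ord => /(_ isT); apply.
    rewrite -(dist_shift mR g).
    have := dist_triangle mP (orb (f g x)) (shift g (v i)) (shift g (v j)).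
    by rewrite (distC m (orb _)); lra.
  move=> i j x /asboolP ix /asboolP jx; apply: val_inj => /=.
  by case: (ltngtP i j) => // ij; [case: (key _ _ _ ix jx)|case: (key _ _ _ jx ix)].
move=> i; rewrite inE => /asboolP[y iy].
(* If [(f g)^-1 y] were not bad, [v i] would be close to its [orb]. *)
exists ((f g)^-1%g y); last by apply/asboolP; rewrite permKV.
rewrite inE permKV; apply/negPn/negP; rewrite !negb_or -ltNge !inE !negbK.
move=> /and3P[/asboolP sx /asboolP sy].
rewrite /err permKV => ex; apply: (vo i _ (ltn_ord i) sx).
rewrite -(dist_shift mR g); apply: (stable_trans (v := orb y)).
- by apply: stable_shift; exact: sv.
- exact: stable_shift.
- by move: iy; lra.
- by rewrite distC.
Qed.

(** Double counting: by stability each [i] is near for more than half of the [g], while each [g] has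
    at most [#|bad g|] near indices. *)
Lemma new_classes_bound k v : new_classes k v ->
  k%:R <= 2 * fa_integral m (fun g => #|bad g|%:R).
Proof.
move=> kv; have [sv _ _] := kv.
pose A (i : 'I_k) := [set g | near (shift g (v i))].
have hA : fa_integral m (fun g => \sum_i (g \in A i)%:R) <=
    fa_integral m (fun g => #|bad g|%:R).
  apply: fa_integral_le => //.
  - by apply: bounded_sum => i; exact: bounded_indic.
  - exact: bounded_bad.
  move=> g; have := card_near_bad g kv; rewrite -(ler_nat R).
  apply: le_trans; rewrite -natr_sum -sum1_card [in leRHS]big_mkcond /=.
  rewrite ler_nat; apply: leq_sum => i _; rewrite inE.
  case: asboolP => h; first by rewrite mem_set.
  by rewrite memNset.
have : \sum_(i < k) 2^-1 <= fa_integral m (fun g => \sum_i (g \in A i)%:R).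
  rewrite fa_integral_sum//; last by move=> i; exact: bounded_indic.
  apply: ler_sum => i _; rewrite fa_integral_indic//; apply: ltW.
  exact: (sv i (ltn_ord i)).
by rewrite sumr_const card_ord -mulr_natl; lra.
Qed.


(** The bound yields a family of maximal size; a class that it missed could be appended at index
    [k]. *)
Lemma new_classes_max : (0 < n)%N -> exists k v, new_classes k v /\
  forall w, stable w ->
    (exists2 i, (i < k)%N & d (v i) w < 3^-1) \/
    (exists2 x, stable (orb x) & d (orb x) w < 3^-1).
Proof.
move=> n0; pose P k := `[< exists v, new_classes k v >].
have P0 : exists k, P k.
  exists 0%N; apply/asboolP; exists (fun _ _ => Ordinal n0).
  by split=> // i j; rewrite ltn0 andbF.
pose B : R := 2 * fa_integral m (fun g => #|bad g|%:R).
have PB k : P k -> (k <= Num.bound B)%N.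
  move=> /asboolP[v /new_classes_bound kB]; apply: ltnW.
  rewrite -(ltr_nat R); apply: le_lt_trans kB _; apply: archi_boundP.
  apply: mulr_ge0 => //; apply: fa_integral_ge0 => //; exact: bounded_bad.
case: (ex_maxnP P0 PB) => k /asboolP[v kv] kmax.
exists k, v; split=> // w sw; apply: contrapT => /not_orP[nv no].
have : (k.+1 <= k)%N; last by rewrite ltnn.
apply: kmax; apply/asboolP; exists (fun i => if (i < k)%N then v i else w).
have [sv vv vo] := kv; split.
- by move=> i _; case: ifP => [/sv|].
- move=> i j /andP[ij]; rewrite ltnS => jk; rewrite (leq_trans ij jk).
  case: ltnP => [jk'|_]; first by apply: vv; rewrite ij.
  by move=> ?; apply: nv; exists i => //; exact: leq_trans jk.
- move=> i x _ sx; case: ltnP => [ik|_]; first exact: vo.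
  by rewrite distC => ?; apply: no; exists x.
Qed.

(** * The action on classes *)

(** By [cover] and [uniq], the translate of a stable [u i] is close to exactly one stable [u j].
    Invariance of the distance makes [i |-> j] injective. *)
Lemma class_action (I : finType) (u : I -> G -> 'I_n) :
  (forall i j, stable (u i) -> stable (u j) -> d (u i) (u j) < 3^-1 -> i = j) ->
  (forall w, stable w -> exists2 i, stable (u i) & d (u i) w < 3^-1) ->
  exists h : G -> {perm I},
    (forall g g' i, h (g * g')%g i = h g (h g' i)) /\
    (forall g i j, stable (u i) -> stable (u j) ->
       d (u j) (shift g (u i)) < 3^-1 -> h g i = j).
Proof.
move=> uniq cover.
pose next g i j := `[< stable (u j) /\ d (u j) (shift g (u i)) < 3^-1 >].
(* Unstable indices are fixed. On stable ones [cover] ensures that the default of [odflt] is never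
   taken. *)
pose F g i := if `[< stable (u i) >] then odflt i [pick j | next g i j] else i.
have FS g i : stable (u i) ->
    stable (u (F g i)) /\ d (u (F g i)) (shift g (u i)) < 3^-1.
  move=> si; rewrite /F asboolT//.
  case: pickP => [j /asboolP//|/=].
  have [j sj dj] := cover _ (stable_shift g si).
  by move=> /(_ j)/asboolPn[].
have FN g i : ~ stable (u i) -> F g i = i by move=> si; rewrite /F asboolF.
have FU g i j : stable (u i) -> stable (u j) ->
    d (u j) (shift g (u i)) < 3^-1 -> F g i = j.
  move=> si sj dj; have [sF dF] := FS g i si; apply: uniq => //.
  by apply: (stable_trans sF sj dF); rewrite distC.
have Finj g : injective (F g).
  move=> i j; have [si|si] := pselect (stable (u i));
    have [sj|sj] := pselect (stable (u j)).
  - have [sFi dFi] := FS g i si; have [sFj dFj] := FS g j sj => e.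
    apply: uniq => //; rewrite -(dist_shift mR g).
    apply: (stable_trans (v := u (F g i))); [exact: stable_shift..| |].
      by rewrite distC.
    by rewrite e.
  - by have [sFi _] := FS g i si; rewrite (FN _ _ sj) => e; rewrite e in sFi.
  - by have [sFj _] := FS g j sj; rewrite (FN _ _ si) => e; rewrite -e in sFj.
  - by rewrite !FN.
exists (fun g => perm (@Finj g)); split=> [g g' i|g i j]; rewrite !permE; last exact: FU.
have [si|si] := pselect (stable (u i)); last by rewrite !FN.
have [s1 d1] := FS g' i si; have [s2 d2] := FS g _ s1.
(* [F g (F g' i)] also represents the translate of [u i] by [g * g'], so uniqueness identifies
   it. *)
apply: FU => //; rewrite -shiftM.
apply: (stable_trans s2 _ d2); last by rewrite (dist_shift mR).
by do 2!apply: stable_shift.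
Qed.

End Clusters.

(** * Construction of the homomorphism and final estimates *)

Theorem theorem1p6 (R : realType) (G : groupType) (m : set G -> R)
    (n : nat) (f : G -> 'S_n) :
  amenable R G ->
  fa_probability m ->
  left_invariant m -> right_invariant m -> inverse_invariant m ->
  (1 <= n)%N ->
  exists (N : nat) (h : G -> 'S_N) (le_nN : (n <= N)%N),
    [/\ {morph h : x y / (x * y)%g >-> perm_comp x y},
        d1 m le_nN f h <= 2913 * def1 m f
      & N%:R <= (1 + 1740 * def1 m f) * n%:R].
Proof.
move=> _ mP _ mR _ n0.
have [k [v [kv vmax]]] := new_classes_max f mP mR n0.
have [sv vv vo] := kv.
(* The points of [f] come first, so that [widen_ord] is [lshift]; the new classes fill the last [k]
   places. *)
pose u (i : 'I_(n + k)) : G -> 'I_n :=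
  match fintype.split i with inl x => orb f x | inr j => v j end.
have uniq i j : stable m f (u i) -> stable m f (u j) ->
    dist m (u i) (u j) < 3^-1 -> i = j.
  rewrite /u -{3}(splitK i) -{3}(splitK j).
  case: (fintype.split i) => x; case: (fintype.split j) => y sx sy dxy /=.
  - congr lshift; apply/eqP; apply: contraTT dxy => xy.
    by rewrite dist_orb// -leNgt; lra.
  - by case: (vo y x (ltn_ord y) sx); rewrite distC.
  - by case: (vo x y (ltn_ord x) sy dxy).
  - congr rshift; apply: val_inj; case: (ltngtP x y) => // xy.
    + by case: (vv x y); rewrite ?xy /=.
    + by case: (vv y x); rewrite ?xy //= distC.
have cover w : stable m f w ->
    exists2 i, stable m f (u i) & dist m (u i) w < 3^-1.
  move=> /vmax[[i ik dw]|[x sx dx]].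
    exists (rshift n (Ordinal ik)); rewrite /u (unsplitK (inr (Ordinal ik)))//.
    exact: sv.
  by exists (lshift k x); rewrite /u (unsplitK (inl x)).
have [h [hM hE]] := class_action mP mR uniq cover.
exists (n + k)%N, h, (leq_addr k n).
have wE x : widen_ord (leq_addr k n) x = lshift k x by exact: val_inj.
have uE x : u (lshift k x) = orb f x by rewrite /u (unsplitK (inl x)).
(* Together these bounds give [k <= 54 * (n * def1 m f)], since 54 = 2 * 27. *)
have kb := new_classes_bound mP mR kv.
have bb := bad_integral f mP n0.
have n0R : 0 < n%:R :> R by rewrite ltr0n.
set D := def1 m f in bb *.
(* The upper bound on the integral of [#|bad g|] already forces the defect to be nonnegative. *)
have D0 : 0 <= D.
  have : 0 <= fa_integral m (fun g => #|bad m f g|%:R).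
    by apply: fa_integral_ge0 => //; exact: bounded_bad.
  by rewrite -(pmulr_rge0 D n0R); lra.
have nD0 := mulr_ge0 (ltW n0R) D0.
split.
- by move=> g g'; apply/permP => i; rewrite perm_compE hM.
- have N0 : 0 < (n + k)%:R :> R by rewrite ltr0n addn_gt0 n0.
  apply: (@le_trans _ _ (fa_integral m (fun g =>
      (n + k)%:R^-1 * (#|bad m f g|%:R + k%:R)))).
    have bbd := bounded_bad m f.
    apply: fa_integral_le => //.
    + apply: (@bounded_itv _ _ _ ((n + k)%:R^-1 * (n + k)%:R)) => g.
      rewrite dHE; apply/andP; split.
        by rewrite mulr_ge0 ?invr_ge0 ?ler0n.
      apply: ler_wpM2l; first by rewrite invr_ge0 ler0n.
      by rewrite ler_nat addKn leq_add2r -[leqRHS]card_ord max_card.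
    + by apply: bounded_scale; apply: bounded_add => //; exact: bounded_cst.
    move=> g; rewrite dHE addKn (natrD _ #|_|); apply: ler_wpM2l.
      by rewrite invr_ge0 ltW.
    (* A disagreement of [h g] with [f g] occurs only at a bad point; the term [k] pays for the
       added points. *)
    rewrite lerD2r ler_nat; apply/subset_leq_card/fintype.subsetP => x.
    rewrite !inE !wE; apply: contraR.
    rewrite !negb_or -ltNge !negbK => /and3P[/asboolP sx /asboolP sy ex].
    by apply/eqP/esym/hE; rewrite ?uE// distC.
  rewrite fa_integralZ//; last first.
    by apply: bounded_add; [exact: bounded_bad|exact: bounded_cst].
  rewrite fa_integralD//; [|exact: bounded_bad|exact: bounded_cst].
  rewrite fa_integral_cst// ler_pdivrMl// natrD.
  (* The left side is at most 81 * n * D, as 81 = 27 + 54, and [k * D >= 0] allows replacing [n] by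
     [n + k] on the right. *)
  have : 0 <= k%:R * D by rewrite mulr_ge0.
  by move=> ?; rewrite mulrCA mulrDl; lra.
- by rewrite natrD mulrDl mul1r; lra.
Qed.
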